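(* Let $A/F$ be a central simple algebra with maximal separable subfield $K$. The map $\Phi$, $$\Phi(S)=\sum_{HgH\subseteq S}\varphi_v(K_{[g]}),$$ is an isomorphism of semirings from the semiring of $H$-bisets in $G$ (with operations union and product of subsets) to the semiring of $K$-$K$ sub-bimodules of $A$ (with operations sum and product of subspaces).
   Context: Setting: $F$ is a field, $A$ is a central simple $F$-algebra of degree $n$ (so $\dim_F A=n^2$), and $K\subset A$ is a maximal subfield, separable over $F$, with $[K:F]=n$. $L$ is the Galois closure of $K/F$, $G=\mathrm{Gal}(L/F)$, $H=\mathrm{Gal}(L/K)$. $A$ is a $K$-$K$-bimodule (a $K\otimes_F K$-module) by left and right multiplication. For $a\in A$, $KaK$ denotes the $F$-span of all $kak'$ with $k,k'\in K$. An $H$-biset is a subset $S\subseteq G$ closed under multiplication by $H$ from the left and from the right (the empty set is allowed), i.e. a union of double cosets of $H$. For $g\in G$ let $\pi_{gH}:K\otimes_F K\to L$ be the ring homomorphism $a\otimes b\mapsto a\,g(b)$. Its kernel depends only on $HgH$, and $K_{[g]}\subset K\otimes_F K$ is the unique minimal ideal of the (commutative semisimple) ring $K\otimes_F K$ not contained in $\ker\pi_{gH}$. Choose $v\in A$ with $KvK=A$ (such $v$ exists) and put $\varphi_v:K\otimes_F K\to A$, $\varphi_v(x\otimes y)=xvy$, an isomorphism of bimodules. The map $\Phi$ does not depend on the choice of $v$. The $H$-bisets form a semiring under union and product $SS'=\{ss'\}$, with zero $\emptyset$ and unit $H$. The $K$-$K$ sub-bimodules of $A$ form a semiring under sum and product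 ($VW$ is the $F$-span of all $vw$), with zero the zero module and unit $K$. *)

(* Defs.v *)
From HB Require Import structures.
From mathcomp Require Import all_boot all_order all_fingroup all_algebra.
From mathcomp Require Import all_solvable all_field.
From Stdlib Require Import ClassicalEpsilon.

Set Implicit Arguments.
Unset Strict Implicit.
Unset Printing Implicit Defensive.

Import GRing.Theory.
Local Open Scope ring_scope.

(* Tensor product over F of two finite dimensional F-algebras: the matrix M   *)
(* stands for \sum_(i, j) M i j e_i \otimes f_j, where (e_i) and (f_j) are    *)
(* the library's chosen bases of B and C.                                     *)

Definition tensor (F : fieldType) (B C : falgType F) : Type :=
  'M[F]_(\dim {:B}, \dim {:C}).

HB.instance Definition _ (F : fieldType) (B C : falgType F) :=
  Vector.copy (tensor B C) 'M[F]_(\dim {:B}, \dim {:C}).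

Section Tensor.
Variables (F : fieldType) (B C : falgType F).
Implicit Types M N P : tensor B C.

Let e := vbasis {:B}.
Let f := vbasis {:C}.

Definition pure (x : B) (y : C) : tensor B C :=
  \matrix_(i, j) (coord e i x * coord f j y).

(* The linear map induced by a bilinear map h; see tlift_pure. *)
Definition tlift (W : lmodType F) (h : B -> C -> W) (M : tensor B C) : W :=
  \sum_i \sum_j (M : 'M_(_, _)) i j *: h e`_i f`_j.

Lemma tliftE (W : lmodType F) (h : B -> C -> W) M :
  tlift h M = \sum_i \sum_j (M : 'M_(_, _)) i j *: h e`_i f`_j.
Proof. by []. Qed.

Lemma tlift_is_linear (W : lmodType F) (h : B -> C -> W) : linear (tlift h).
Proof.
move=> a M N; rewrite /tlift scaler_sumr -big_split; apply: eq_bigr => i _ /=.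
rewrite scaler_sumr -big_split; apply: eq_bigr => j _ /=.
by rewrite !mxE scalerDl scalerA.
Qed.

HB.instance Definition _ (W : lmodType F) (h : B -> C -> W) :=
  GRing.isLinear.Build F (tensor B C) W _ (tlift h) (tlift_is_linear h).

Lemma pure_linearl y : linear (pure^~ y).
Proof.
by move=> a x x'; apply/matrixP=> i j; rewrite !mxE linearP mulrDl mulrA.
Qed.

Lemma pure_linearr x : linear (pure x).
Proof.
by move=> a y y'; apply/matrixP=> i j; rewrite !mxE linearP mulrDr mulrCA.
Qed.

Lemma coord_e (x : B) : x = \sum_i coord e i x *: e`_i.
Proof. by apply: coord_vbasis; rewrite memvf. Qed.

Lemma coord_f (y : C) : y = \sum_i coord f i y *: f`_i.
Proof. by apply: coord_vbasis; rewrite memvf. Qed.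

Lemma tlift_pure (W : lmodType F) (h : B -> C -> W) x y :
  (forall y, linear (h^~ y)) -> (forall x, linear (h x)) ->
  tlift h (pure x y) = h x y.
Proof.
move=> hl hr.
pose Hl y := GRing.isLinear.Build F B W _ (h^~ y) (hl y).
pose hL y : {linear B -> W} := HB.pack (h^~ y) (Hl y).
pose Hr x := GRing.isLinear.Build F C W _ (h x) (hr x).
pose hR x : {linear C -> W} := HB.pack (h x) (Hr x).
have -> : h x y = hL y x by [].
rewrite {2}(coord_e x) linear_sum; apply: eq_bigr => i _.
rewrite linearZ /=; have -> : h e`_i y = hR e`_i y by [].
rewrite {2}(coord_f y) linear_sum scaler_sumr; apply: eq_bigr => j _.
by rewrite linearZ /= scalerA mxE.
Qed.

Lemma tensorE M : M = \sum_i \sum_j (M : 'M_(_, _)) i j *: pure e`_i f`_j.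
Proof.
have fe : free e by apply: basis_free (vbasisP _).
have ff : free f by apply: basis_free (vbasisP _).
rewrite [LHS]matrix_sum_delta; apply: eq_bigr => i _; apply: eq_bigr => j _.
have -> // : pure e`_i f`_j = delta_mx i j.
by apply/matrixP=> k l; rewrite !mxE !coord_free // -natrM mulnb eq_sym (eq_sym j).
Qed.

Lemma tensor_ext (W : lmodType F) (g h : tensor B C -> W) :
  linear g -> linear h -> (forall x y, g (pure x y) = h (pure x y)) -> g =1 h.
Proof.
move=> gl hl gh M.
pose G : {linear tensor B C -> W} := HB.pack g
  (GRing.isLinear.Build F (tensor B C) W _ g gl).
pose H : {linear tensor B C -> W} := HB.pack h
  (GRing.isLinear.Build F (tensor B C) W _ h hl).
have -> : g M = G M by []; have -> : h M = H M by [].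
rewrite (tensorE M) !linear_sum; apply: eq_bigr => i _.
rewrite !linear_sum; apply: eq_bigr => j _.
by rewrite !linearZ /= gh.
Qed.

Definition tmul M N : tensor B C :=
  tlift (fun x y => tlift (fun x' y' => pure (x * x') (y * y')) N) M.

Lemma tmul_linearl N : linear (tmul^~ N).
Proof. exact: tlift_is_linear. Qed.

Lemma tmul_linearr M : linear (tmul M).
Proof.
move=> a N P; rewrite /tmul !(tliftE _ M) scaler_sumr -big_split.
apply: eq_bigr => i _ /=.
rewrite scaler_sumr -big_split; apply: eq_bigr => j _ /=.
by rewrite tlift_is_linear scalerDr !scalerA mulrC.
Qed.

Lemma tmul_pure x y x' y' :
  tmul (pure x y) (pure x' y') = pure (x * x') (y * y').
Proof.
have inner u w : tlift (fun x' y' => pure (u * x') (w * y')) (pure x' y')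
  = pure (u * x') (w * y').
  apply: tlift_pure => [z | z] a s t.
    by rewrite mulrDr -scalerAr pure_linearl.
  by rewrite mulrDr -scalerAr pure_linearr.
rewrite /tmul tlift_pure ?inner // => [z | z] a s t; rewrite !inner.
  by rewrite mulrDl -scalerAl pure_linearl.
by rewrite mulrDl -scalerAl pure_linearr.
Qed.

Lemma tmulA : associative tmul.
Proof.
move=> M N P; move: M; apply: tensor_ext => [a M M' | a M M' | x y].
- by rewrite tmul_linearl.
- by rewrite !tmul_linearl.
move: N; apply: tensor_ext => [a M M' | a M M' | x' y'].
- by rewrite tmul_linearl tmul_linearr.
- by rewrite tmul_linearr tmul_linearl.
move: P; apply: tensor_ext => [a M M' | a M M' | x'' y''].
- by rewrite !tmul_linearr.
- by rewrite tmul_linearr.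
by rewrite !tmul_pure !mulrA.
Qed.

Lemma tmul1 : left_id (pure 1 1) tmul.
Proof.
apply: tensor_ext => [a M M' | // | x y]; first by rewrite tmul_linearr.
by rewrite tmul_pure !mul1r.
Qed.

Lemma tmulr1 : right_id (pure 1 1) tmul.
Proof.
apply: tensor_ext => [a M M' | // | x y]; first by rewrite tmul_linearl.
by rewrite tmul_pure !mulr1.
Qed.

Lemma tmulDl : left_distributive tmul +%R.
Proof. by move=> M N P; have := tmul_linearl P 1 M N; rewrite !scale1r. Qed.

Lemma tmulDr : right_distributive tmul +%R.
Proof. by move=> M N P; have := tmul_linearr M 1 N P; rewrite !scale1r. Qed.

Lemma pure11_neq0 : pure 1 1 != 0.
Proof.
have /existsP[i ei] : [exists i, coord e i 1 != 0].
  apply: contraT; rewrite negb_exists => /forallP h.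
  have := oner_neq0 B; rewrite (coord_e 1) big1 ?eqxx // => i _.
  by rewrite (eqP (negbNE (h i))) scale0r.
have /existsP[j fj] : [exists j, coord f j 1 != 0].
  apply: contraT; rewrite negb_exists => /forallP h.
  have := oner_neq0 C; rewrite (coord_f 1) big1 ?eqxx // => j _.
  by rewrite (eqP (negbNE (h j))) scale0r.
apply/eqP=> /matrixP/(_ i j)/eqP; rewrite !mxE mulf_eq0.
by rewrite (negbTE ei) (negbTE fj).
Qed.

HB.instance Definition _ := GRing.Zmodule_isNzRing.Build (tensor B C)
  tmulA tmul1 tmulr1 tmulDl tmulDr pure11_neq0.

Lemma tscaleAl a M N : a *: (M * N) = (a *: M) * N.
Proof.
by have /esym := tmul_linearl N a M 0; rewrite (mul0r N : tmul 0 N = 0) !addr0.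
Qed.

Lemma tscaleAr a M N : a *: (M * N) = M * (a *: N).
Proof.
by have /esym := tmul_linearr M a N 0; rewrite (mulr0 M : tmul M 0 = 0) !addr0.
Qed.

HB.instance Definition _ :=
  GRing.Lmodule_isLalgebra.Build F (tensor B C) tscaleAl.
HB.instance Definition _ :=
  GRing.Lalgebra_isAlgebra.Build F (tensor B C) tscaleAr.
HB.instance Definition _ := Algebra_isFalgebra.Build F (tensor B C).

Lemma pureM x y x' y' : pure x y * pure x' y' = pure (x * x') (y * y').
Proof. exact: tmul_pure. Qed.

End Tensor.

(* In a unital finite dimensional algebra every two-sided ideal is a subspace. *)
Definition is_ideal (F : fieldType) (B : falgType F) (I : {vspace B}) : bool :=
  ({:B} * I <= I)%VS && (I * {:B} <= I)%VS.

Definition minimal_ideal (F : fieldType) (B : falgType F) (I : {vspace B}) :=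
  [/\ is_ideal I, I <> 0%VS &
      forall J : {vspace B}, is_ideal J -> (J <= I)%VS -> J = 0%VS \/ J = I].

Definition central_simple (F : fieldType) (A : falgType F) : Prop :=
  'Z({:A})%VS = 1%VS
  /\ forall I : {vspace A}, is_ideal I -> I = 0%VS \/ I = fullv.

Definition is_subfield (F : fieldType) (A : falgType F) (E : {vspace A}) :=
  [/\ 1 \in E, (E * E <= E)%VS, {in E &, commutative *%R} &
      forall x, x \in E -> x != 0 -> x \is a GRing.unit /\ x^-1 \in E].

Definition maximal_subfield (F : fieldType) (A : falgType F) (E : {vspace A}) :=
  is_subfield E
  /\ forall E' : {vspace A}, is_subfield E' -> (E <= E')%VS -> E' = E.

(* L / F is the Galois closure of K / F. *)
Definition galois_closure (F : fieldType) (L : splittingFieldType F)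
    (K : {subfield L}) : Prop :=
  galois 1 {:L}
  /\ forall E : {subfield L}, (K <= E)%VS -> galois 1 E -> E = {:L}%AS.

Section Bisets.
Variables (F : fieldType) (L : splittingFieldType F) (K : {subfield L}).

Local Notation G := 'Gal({:L} / 1%VS)%g.
Local Notation H := 'Gal({:L} / K)%g.

Definition is_biset (S : {set gal_of {:L}}) : bool :=
  [&& S \subset G, (H * S)%g \subset S & (S * H)%g \subset S].

Record biset := Biset {biset_set :> {set gal_of {:L}}; _ : is_biset biset_set}.

HB.instance Definition _ := [isSub for biset_set].
HB.instance Definition _ := [Choice of biset by <:].

(* The library's product on gal_of is (s * t)%g a = t (s a), the opposite of  *)
(* composition of maps, hence the swap: biset_mul S S' consists of the        *)
(* composites a |-> s (s' a) with s in S and s' in S'.                        *)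
Definition set_biset_mul (S S' : {set gal_of {:L}}) : {set gal_of {:L}} :=
  [set (s' * s)%g | s in S, s' in S'].

Lemma set_biset_mulE S S' : set_biset_mul S S' = (S' * S)%g.
Proof.
apply/setP=> x; apply/imset2P/mulsgP=> -[s s' sS s'S ->].
  by exists s' s.
by exists s' s.
Qed.

Lemma set0_is_biset : is_biset set0.
Proof. by rewrite /is_biset sub0set mulg0 mul0g sub0set. Qed.

Lemma setU_is_biset (S S' : biset) : is_biset (S :|: S').
Proof.
case: S S' => [S /and3P[SG HS SH]] [S' /and3P[SG' HS' SH']] /=.
by apply/and3P; split; rewrite ?subUset ?SG // ?mulgU ?mulUg setUSS.
Qed.

Lemma gal_is_biset : is_biset H.
Proof. by rewrite /is_biset galS ?sub1v //= mulGid subxx. Qed.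

Lemma set_biset_mul_is_biset (S S' : biset) : is_biset (set_biset_mul S S').
Proof.
case: S S' => [S /and3P[SG HS SH]] [S' /and3P[SG' HS' SH']] /=.
rewrite set_biset_mulE; apply/and3P; split; first exact: mul_subG.
  by rewrite mulgA mulSg.
by rewrite -mulgA mulgS.
Qed.

Definition biset0 := Biset set0_is_biset.
Definition bisetU S S' := Biset (setU_is_biset S S').
Definition biset1 := Biset gal_is_biset.
Definition biset_mul S S' := Biset (set_biset_mul_is_biset S S').

Lemma bisetUA : associative bisetU.
Proof. by move=> S T U; apply: val_inj; apply: setUA. Qed.
Lemma bisetUC : commutative bisetU.
Proof. by move=> S T; apply: val_inj; apply: setUC. Qed.
Lemma biset0U : left_id biset0 bisetU.
Proof. by move=> S; apply: val_inj; apply: set0U. Qed.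
Lemma biset_mulA : associative biset_mul.
Proof. by move=> S T U; apply: val_inj; rewrite /= !set_biset_mulE mulgA. Qed.
Lemma biset_mul1 : left_id biset1 biset_mul.
Proof.
case=> S HS; apply: val_inj; rewrite /= set_biset_mulE; case/and3P: HS => _ _ SH.
by apply/eqP; rewrite eqEsubset SH mulg_subl ?group1.
Qed.
Lemma biset_mulr1 : right_id biset1 biset_mul.
Proof.
case=> S HS; apply: val_inj; rewrite /= set_biset_mulE; case/and3P: HS => _ HS _.
by apply/eqP; rewrite eqEsubset HS mulg_subr ?group1.
Qed.
Lemma biset_mulDl : left_distributive biset_mul bisetU.
Proof. by move=> S T U; apply: val_inj; rewrite /= !set_biset_mulE mulgU. Qed.
Lemma biset_mulDr : right_distributive biset_mul bisetU.
Proof. by move=> S T U; apply: val_inj; rewrite /= !set_biset_mulE mulUg. Qed.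
Lemma biset_mul0 : left_zero biset0 biset_mul.
Proof. by move=> S; apply: val_inj; rewrite /= set_biset_mulE mulg0. Qed.
Lemma biset_mulr0 : right_zero biset0 biset_mul.
Proof. by move=> S; apply: val_inj; rewrite /= set_biset_mulE mul0g. Qed.

HB.instance Definition _ := GRing.isPzSemiRing.Build biset
  bisetUA bisetUC biset0U biset_mulA biset_mul1 biset_mulr1
  biset_mulDl biset_mulDr biset_mul0 biset_mulr0.

End Bisets.

(* K embeds in A through j; limg j is the copy of K inside A. *)
Section Subbimodules.
Variables (F : fieldType) (A : falgType F) (L : splittingFieldType F).
Variables (K : {subfield L}) (j : 'AHom(subvs_of K, A)).

Definition is_subbimod (V : {vspace A}) : bool :=
  (limg j * V <= V)%VS && (V * limg j <= V)%VS.

Record subbimod :=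
  Subbimod {subbimod_space :> {vspace A}; _ : is_subbimod subbimod_space}.

HB.instance Definition _ := [isSub for subbimod_space].
HB.instance Definition _ := [Choice of subbimod by <:].

Lemma vspace0_is_subbimod : is_subbimod 0%VS.
Proof. by rewrite /is_subbimod prodv0 prod0v subvv. Qed.

Lemma addv_is_subbimod (V W : subbimod) : is_subbimod (V + W)%VS.
Proof.
case: V W => [V /andP[KV VK]] [W /andP[KW WK]] /=.
by rewrite /is_subbimod prodvDr prodvDl !addvS.
Qed.

Lemma limg_is_subbimod : is_subbimod (limg j).
Proof.
suff h : (limg j * limg j <= limg j)%VS by rewrite /is_subbimod h.
apply/prodvP=> _ _ /memv_imgP[x _ ->] /memv_imgP[y _ ->].
by rewrite -rmorphM memv_img ?memvf.
Qed.

Lemma prodv_is_subbimod (V W : subbimod) : is_subbimod (V * W)%VS.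
Proof.
case: V W => [V /andP[KV VK]] [W /andP[KW WK]] /=.
by rewrite /is_subbimod prodvA prodvSl //= -prodvA prodvSr.
Qed.

Definition subbimod0 := Subbimod vspace0_is_subbimod.
Definition subbimodD V W := Subbimod (addv_is_subbimod V W).
Definition subbimod1 := Subbimod limg_is_subbimod.
Definition subbimodM V W := Subbimod (prodv_is_subbimod V W).

Lemma limg1 : 1 \in limg j.
Proof. by rewrite -(rmorph1 j) memv_img ?memvf. Qed.

Lemma subbimodDA : associative subbimodD.
Proof. by move=> U V W; apply: val_inj; apply: addvA. Qed.
Lemma subbimodDC : commutative subbimodD.
Proof. by move=> V W; apply: val_inj; apply: addvC. Qed.
Lemma subbimod0D : left_id subbimod0 subbimodD.
Proof. by move=> V; apply: val_inj; apply: add0v. Qed.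
Lemma subbimodMA : associative subbimodM.
Proof. by move=> U V W; apply: val_inj; apply: prodvA. Qed.
Lemma subbimod1M : left_id subbimod1 subbimodM.
Proof.
case=> V HV; apply: val_inj => /=; case/andP: HV => KV _.
by apply/eqP; rewrite eqEsubv KV -{1}(prod1v V) prodvSl // -memvE limg1.
Qed.
Lemma subbimodM1 : right_id subbimod1 subbimodM.
Proof.
case=> V HV; apply: val_inj => /=; case/andP: HV => _ VK.
by apply/eqP; rewrite eqEsubv VK -{1}(prodv1 V) prodvSr // -memvE limg1.
Qed.
Lemma subbimodMDl : left_distributive subbimodM subbimodD.
Proof. by move=> U V W; apply: val_inj; apply: prodvDl. Qed.
Lemma subbimodMDr : right_distributive subbimodM subbimodD.
Proof. by move=> U V W; apply: val_inj; apply: prodvDr. Qed.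
Lemma subbimod0M : left_zero subbimod0 subbimodM.
Proof. by move=> V; apply: val_inj; apply: prod0v. Qed.
Lemma subbimodM0 : right_zero subbimod0 subbimodM.
Proof. by move=> V; apply: val_inj; apply: prodv0. Qed.

HB.instance Definition _ := GRing.isPzSemiRing.Build subbimod
  subbimodDA subbimodDC subbimod0D subbimodMA subbimod1M subbimodM1
  subbimodMDl subbimodMDr subbimod0M subbimodM0.

Local Notation KK := (tensor (subvs_of K) (subvs_of K)).

(* a \otimes b |-> a g(b) *)
Definition pi_coset (g : gal_of {:L}) : 'Hom(KK, L) :=
  linfun (tlift (fun a b : subvs_of K => vsval a * g (vsval b))).

(* The ideal K_[g]: the description operator picks the unique minimal ideal   *)
(* of K \otimes K not contained in the kernel of pi_coset g.                  *)
Definition Kdc (g : gal_of {:L}) : {vspace KK} :=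
  epsilon (inhabits 0%VS)
    (fun I => minimal_ideal I /\ ~~ (I <= lker (pi_coset g))%VS).

(* x \otimes y |-> x v y *)
Definition phi (v : A) : 'Hom(KK, A) :=
  linfun (tlift (fun x y : subvs_of K => j x * v * j y)).

(* Indexed by the g with HgH included in S rather than by double cosets:      *)
(* Kdc g depends only on HgH, and repeating a subspace does not change a sum. *)
Definition Phi_map (v : A) (S : {set gal_of {:L}}) : {vspace A} :=
  (\sum_(g in 'Gal({:L} / 1%VS)%g |
         ('Gal({:L} / K) :* g * 'Gal({:L} / K))%g \subset S)
     (phi v @: Kdc g))%VS.

End Subbimodules.

(* Main.v *)
Require Import Defs.
From HB Require Import structures.
From mathcomp Require Import all_boot all_order all_fingroup all_algebra.
From mathcomp Require Import all_solvable all_field.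

Set Implicit Arguments.
Unset Strict Implicit.
Unset Printing Implicit Defensive.

Import GRing.Theory.
Local Open Scope ring_scope.

(** For s, t in Gal(L/F) let E_{s,t} : A -> L send x v y to s(x) t(y); it is
    well defined because x \otimes y |-> x v y is bijective, KvK = A having the
    same dimension n^2 as K \otimes K.  Since E_{s,t} depends only on the
    restrictions of s and t to K, it plays the role of an entry of an n x n
    matrix indexed by the embeddings of K into L.

    The argument has two halves.  The first is about K \otimes K alone.  By
    Dedekind's independence of embeddings, evaluation at all the maps
    x \otimes y |-> x g(y) identifies K \otimes K with the ring of all
    H-equivariant functions Gal(L/F) -> L ([teval_inj], [teval_surj]).  Hence an
    ideal is determined by the biset of those g at which it does not vanish
    ([ideal_support]).  The ideal K_[g] consists of the elements that vanish off
    HgH ([mem_Kdc]), and Phi(S) is the set of the a in A such that E_{1,g}(a)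
    is 0 for all g outside S ([mem_Phi]).  Bijectivity, additivity and
    Phi(H) = K follow.

    The second half is multiplicativity.  Dedekind again gives structure
    constants with
        E_{s,r}(a b) = \sum_t c_{s,t,r} E_{s,t}(a) E_{t,r}(b),
    t ranging over the embeddings ([struct_exist]).  The inclusion of
    Phi(S) Phi(S') in Phi(SS') can be read off this formula.  For the converse
    it suffices that no c_{s,t,r} is 0: if a in Phi(S) and b in Phi(S') have
    E_{1,s}(a) <> 0 and E_{s,ss'}(b) <> 0, then E_{1,ss'}(a k b) is, as a
    function of k in K, a combination of embeddings in which s has a nonzero
    coefficient, so it is nonzero for some k.  That the constants do not vanish
    ([struct_neq0]) comes from the associativity of A, which makes c a cocycle,
    and from its simplicity: the a with E_{s,t}(a) = 0 for all s, t such that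
    c_{s,t,s} <> 0 form a proper two-sided ideal, which must be 0, and this
    forces every c_{s,t,s} to be nonzero.  The cocycle identity does the
    rest. *)

(** * Embeddings of K into L *)

Section Embeddings.
Variables (F : fieldType) (L : splittingFieldType F) (K : {subfield L}).
Hypothesis galL : galois 1 {:L}.

Local Notation gT := (gal_of {:L}).
Local Notation H := 'Gal({:L} / K)%g.
Local Notation kT := (subvs_of K).
Local Notation k_ := (vbasis {:kT}).

Lemma mem_gal1 (g : gT) : g \in 'Gal({:L} / 1%VS)%g.
Proof. by rewrite gal_kHom ?sub1v // k1AHom. Qed.

Lemma galLK : galois K {:L}.
Proof. by rewrite (galoisS _ galL) ?sub1v ?subvf. Qed.

Lemma gal_comp (s t : gT) a : (s * t)%g a = t (s a).
Proof. by rewrite galM ?memvf. Qed.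

Lemma eq_embeddingP (s t : gT) :
  reflect (forall k : kT, s (vsval k) = t (vsval k)) (s \in (H :* t)%g).
Proof.
rewrite mem_rcoset gal_kHom ?subvf //; apply: (iffP idP) => [|st].
  case/andP=> _ /subvP fixK k.
  have /fixK/fixedSpaceP := subvsP k; rewrite gal_comp => e.
  by rewrite -[in RHS]e -gal_comp mulVg gal_id.
apply/andP; split; first by rewrite -k1HomE k1AHom.
apply/subvP=> x Kx; apply/fixedSpaceP; rewrite gal_comp.
by rewrite -(vsprojK Kx) st -gal_comp mulgV gal_id.
Qed.

(** Two automorphisms in the same coset of H restrict to the same embedding of
    K, so the representatives below index the embeddings. *)
Definition coset_rep (g : gT) : gT := repr (H :* g)%g.
Definition coset_reps : {set gT} := [set coset_rep g | g : gT].

Lemma coset_rep_coset g : (H :* coset_rep g = H :* g)%g.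
Proof. exact/rcoset_eqP/mem_repr_rcoset. Qed.

Lemma coset_rep_eq s t : (coset_rep s == coset_rep t) = (s \in H :* t)%g.
Proof.
apply/eqP/idP=> [st | /rcoset_eqP st]; last by rewrite /coset_rep st.
by rewrite -(coset_rep_coset t) -st coset_rep_coset rcoset_refl.
Qed.

Lemma coset_repE g k : coset_rep g (vsval k : L) = g (vsval (k : kT)).
Proof. by apply/eq_embeddingP; rewrite -coset_rep_coset rcoset_refl. Qed.

Lemma coset_rep_reps g : coset_rep g \in coset_reps.
Proof. exact: imset_f. Qed.

Lemma coset_rep_id t : t \in coset_reps -> coset_rep t = t.
Proof. by case/imsetP=> g _ ->; rewrite /coset_rep coset_rep_coset. Qed.

Lemma card_coset_reps : #|coset_reps| = \dim {:kT}.
Proof.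
have -> : #|coset_reps| = #|rcosets H [set: gT]|.
  rewrite -(card_in_imset (f := repr) (D := rcosets H _)); last first.
    move=> _ _ /rcosetsP[s _ ->] /rcosetsP[t _ ->] st.
    by apply: rcoset_eqP; rewrite -coset_rep_eq; apply/eqP.
  congr #|pred_of_set _|; apply/setP=> g.
  apply/imsetP/imsetP=> [[s _ ->]|[_ /rcosetsP[s _ ->] ->]].
    by exists (H :* s)%g => //; apply/rcosetsP; exists s; rewrite ?inE.
  by exists s.
have GT : 'Gal({:L} / 1)%g = [set: gT].
  by apply/setP=> g; rewrite mem_gal1 inE.
have cG : #|[set: gT]| = \dim {:L}.
  by rewrite -GT -(galois_dim galL) dimv1 divn1.
apply/eqP; rewrite dimvf /= -(eqn_pmul2l (cardG_gt0 H)).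
rewrite (Lagrange (subsetT H)) /= cG.
by rewrite -(galois_dim galLK) divnK ?field_dimS ?subvf.
Qed.

(** Composing a relation among the embeddings of K with the trace of L/K gives a
    relation among all the automorphisms of L, in which each coefficient is
    repeated along a coset of H; these are independent. *)
Lemma embeddings_independent (c : gT -> L) :
  (forall k : kT, \sum_(t in coset_reps) c t * t (vsval k) = 0) ->
  forall t, t \in coset_reps -> c t = 0.
Proof.
move=> c0 t Xt.
suff /gal_independent/(_ t isT): forall a, a \in {:L}%VS ->
    \sum_(g : gT | predT g) c (coset_rep g) * g a = 0 by rewrite coset_rep_id.
move=> a _; have Ka := mem_galTrace galLK (memvf a).
rewrite -[RHS](c0 (vsproj K (galTrace K {:L} a))) vsprojK //.
rewrite (partition_big coset_rep (mem coset_reps)) /=; last first.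
  by move=> g _; apply: coset_rep_reps.
apply: eq_bigr => s Xs; rewrite /galTrace rmorph_sum mulr_sumr.
rewrite (reindex_inj (mulIg s)) /=; apply: eq_big => [h | h /eqP].
  by rewrite -{2}(coset_rep_id Xs) coset_rep_eq mem_rcoset mulgK.
by move=> ->; rewrite gal_comp.
Qed.

Definition embedding_mx : 'M[L]_(#|coset_reps|, \dim {:kT}) :=
  \matrix_(i, j) (enum_val i : gT) (vsval (k_`_j)).

Lemma gal_coord (g : gT) (k : kT) :
  g (vsval k) = \sum_i coord k_ i k *: g (vsval k_`_i).
Proof.
rewrite {1}(coord_vbasis (memvf k)) !linear_sum.
by apply: eq_bigr => i _; rewrite !linearZ.
Qed.

Lemma embedding_mx_free : row_free embedding_mx.
Proof.
apply/inj_row_free => u u0; apply/rowP=> i; rewrite [RHS]mxE.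
pose c t := u 0 (enum_rank_in (enum_valP i) t).
have c_val r : c (enum_val r) = u 0 r by rewrite /c enum_valK_in.
rewrite -c_val; apply: embeddings_independent (enum_valP i) => k.
under eq_bigr do rewrite gal_coord mulr_sumr.
rewrite exchange_big big1 // => m _ /=.
under eq_bigr do rewrite -scalerAr.
rewrite -scaler_sumr big_enum_val /=.
rewrite -[RHS](scaler0 _ (coord k_ m k)); congr (_ *: _).
move/rowP/(_ m): u0; rewrite !mxE => u0m; rewrite -[RHS]u0m.
by apply: eq_bigr => r _; rewrite c_val mxE.
Qed.

(** The matrix of the values of the embeddings at a basis of K is square with
    independent rows, hence invertible.  So linear systems indexed by the
    embeddings have unique solutions; they are written over the whole Galois
    group, which makes the Galois action on them a plain substitution. *)
Lemma embedding_eqs_inj (x : 'I_(\dim {:kT}) -> L) :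
  (forall g : gT, \sum_i x i * g (vsval k_`_i) = 0) -> forall i, x i = 0.
Proof.
move=> x0 i.
have /row_freeP[B MB] := embedding_mx_free.
have : row_full embedding_mx.
  by rewrite /row_full (eqP embedding_mx_free) card_coset_reps.
case/row_fullP=> B' BM.
have /colP/(_ i) : B' *m (embedding_mx *m \col_i x i) = 0.
  suff -> : embedding_mx *m \col_i x i = 0 by rewrite mulmx0.
  apply/colP=> r; rewrite !mxE -[RHS](x0 (enum_val r)).
  by apply: eq_bigr => m _; rewrite !mxE mulrC.
by rewrite mulmxA BM mul1mx !mxE.
Qed.

Lemma embedding_eqs_solvable (y : gT -> L) :
  (forall s t : gT, s \in (H :* t)%g -> y s = y t) ->
  exists x : 'I_(\dim {:kT}) -> L,
    forall g : gT, \sum_i x i * g (vsval k_`_i) = y g.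
Proof.
move=> yH; have /row_freeP[B MB] := embedding_mx_free.
pose z := B *m \col_r y (enum_val r); exists (fun i => z i 0) => g.
have Xg := coset_rep_reps g.
have yg : y (coset_rep g) = y g.
  by apply: yH; rewrite -coset_rep_coset rcoset_refl.
have : embedding_mx *m z = \col_r y (enum_val r) by rewrite mulmxA MB mul1mx.
move/colP/(_ (enum_rank_in Xg (coset_rep g))).
rewrite !mxE enum_rankK_in // yg => <-; apply: eq_bigr => i _.
by rewrite [embedding_mx _ _]mxE enum_rankK_in // coset_repE mulrC.
Qed.

(** The columns of the inverse matrix.  Uniqueness of the solutions makes them
    Galois equivariant.  The last clause expresses the coordinates on K, hence
    every F-linear map from K to L, through the embeddings. *)
Lemma dual_family :
  exists l : gT -> 'I_(\dim {:kT}) -> L,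
  [/\ forall s t : gT, \sum_i l t i * s (vsval k_`_i) = (s \in H :* t)%g%:R,
      forall (s t : gT) i, s \in (H :* t)%g -> l s i = l t i,
      forall (g t : gT) i, g (l t i) = l (t * g)%g i &
      forall k i,
        \sum_(t in coset_reps) l t i * t (vsval k) = (coord k_ i k)%:A].
Proof.
have /fin_all_exists[l lP] (t : gT) : exists x : 'I_(\dim {:kT}) -> L,
    forall s : gT, \sum_i x i * s (vsval k_`_i) = (s \in H :* t)%g%:R.
  apply: embedding_eqs_solvable => r s /rcoset_eqP rs.
  by congr (nat_of_bool _)%:R; apply/rcoset_eqP/rcoset_eqP; rewrite rs.
exists l; split=> // [s t i /rcoset_eqP st | g t i | k i].
- apply/eqP; rewrite -subr_eq0; apply/eqP; move: i.
  apply: embedding_eqs_inj => g.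
  under eq_bigr do rewrite mulrBl.
  by rewrite sumrB !lP st subrr.
- apply/eqP; rewrite -subr_eq0; apply/eqP; move: i.
  apply: embedding_eqs_inj => s.
  under eq_bigr do rewrite mulrBl.
  rewrite sumrB lP.
  have -> : \sum_i g (l t i) * s (vsval k_`_i) =
            g (\sum_i l t i * (s * g^-1)%g (vsval k_`_i)).
    rewrite rmorph_sum; apply: eq_bigr => i _.
    by rewrite rmorphM /= -gal_comp mulgKV.
  by rewrite lP rmorph_nat !mem_rcoset invMg mulgA subrr.
apply/eqP; rewrite -subr_eq0; apply/eqP; move: i.
apply: embedding_eqs_inj => s.
under eq_bigr do rewrite mulrBl.
rewrite sumrB; apply/eqP; rewrite subr_eq0; apply/eqP.
under [RHS]eq_bigr do rewrite mulr_algl.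
rewrite -gal_coord -coset_repE.
under eq_bigr do rewrite mulr_suml.
rewrite exchange_big (bigD1 (coset_rep s)) ?coset_rep_reps //= [X in _ + X]big1.
  rewrite addr0; under eq_bigr do rewrite mulrAC.
  by rewrite -mulr_suml lP coset_rep_coset rcoset_refl mul1r.
move=> t /andP[Xt tNs]; under eq_bigr do rewrite mulrAC.
rewrite -mulr_suml lP -coset_rep_eq (coset_rep_id Xt) eq_sym (negPf tNs).
by rewrite mul0r.
Qed.

(** * The ring K \otimes K and its ideals *)

Local Notation KK := (tensor kT kT).

(** The two-sided variant of the projections x \otimes y |-> x g(y): the group
    then acts by g(teval s r t) = teval (g s) (g r) t, where g s is composition
    of maps, written s * g. *)
Definition teval (s r : gT) : 'Hom(KK, L) :=
  linfun (tlift (fun a b : kT => s (vsval a) * r (vsval b))).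

Arguments teval (s r)%_g.

Lemma teval_pure s r x y : teval s r (pure x y) = s (vsval x) * r (vsval y).
Proof.
rewrite lfunE /= tlift_pure // => [b | a] c u w.
  by rewrite !linearP /= mulrDl scalerAl.
by rewrite !linearP /= mulrDr scalerAr.
Qed.

Lemma pi_cosetE g : pi_coset K g =1 teval 1 g.
Proof.
move=> t; rewrite !lfunE /= !tliftE; do 2![apply: eq_bigr => ? _].
by rewrite gal_id.
Qed.

Lemma tevalM s r t u : teval s r (t * u) = teval s r t * teval s r u.
Proof.
move: t; apply: (tensor_ext (g := fun t => teval s r (t * u))
  (h := fun t => teval s r t * teval s r u)) => [a t t' | a t t' | x y].
- by rewrite mulrDl -scalerAl linearP.
- by rewrite linearP mulrDl -scalerAl.
move: u; apply: (tensor_ext (g := fun u => teval s r (pure x y * u))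
  (h := fun u => teval s r (pure x y) * teval s r u))
  => [a t t' | a t t' | x' y'].
- by rewrite mulrDr -scalerAr linearP.
- by rewrite linearP mulrDr -scalerAr.
by rewrite pureM !teval_pure !rmorphM mulrACA.
Qed.

Lemma teval1 s r : teval s r 1 = 1.
Proof. by rewrite [1 : KK]/(pure 1 1) teval_pure !rmorph1 mulr1. Qed.

Lemma gal_teval (g s r : gT) t : g (teval s r t) = teval (s * g) (r * g) t.
Proof.
move: t; apply: (tensor_ext (g := fun t => g (teval s r t)))
  => [a t t' | a t t' | x y].
- by rewrite !linearP.
- by rewrite linearP.
by rewrite !teval_pure rmorphM /= !gal_comp.
Qed.

Lemma teval_coset s s' r r' t :
  s \in (H :* s')%g -> r \in (H :* r')%g -> teval s r t = teval s' r' t.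
Proof.
move=> /eq_embeddingP ss /eq_embeddingP rr; move: t.
apply: tensor_ext => [a t t' | a t t' | x y]; rewrite ?linearP //.
by rewrite !teval_pure ss rr.
Qed.

(** Write t as the sum of the x_m \otimes k_m over a basis (k_m) of K: the
    vanishing of its values is a homogeneous linear system in the x_m. *)
Lemma teval_inj t : (forall g, teval 1 g t = 0) -> t = 0.
Proof.
move=> t0; pose x m := \sum_i (t : 'M_(_, _)) i m *: vsval (k_`_i : kT).
have x0 : forall m, x m = 0.
  apply: embedding_eqs_inj => g.
  rewrite -[RHS](t0 g) lfunE /= tliftE exchange_big.
  apply: eq_bigr => m _; rewrite mulr_suml; apply: eq_bigr => i _.
  by rewrite gal_id scalerAl.
apply/matrixP=> i m; rewrite [RHS]mxE.
have /freeP := basis_free (vbasisP {:kT}).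
move/(_ (fun i => (t : 'M_(_, _)) i m)); apply.
apply: val_inj; rewrite /= -[RHS](x0 m) /x linear_sum.
by apply: eq_bigr => r _; rewrite linearZ.
Qed.

(** Solve the linear system for the coefficients x_m; by uniqueness the
    equivariance of y makes them H-invariant, so they lie in K. *)
Lemma teval_surj (y : gT -> L) :
  (forall h g : gT, h \in H -> y (h * g)%g = y g) ->
  (forall h g : gT, h \in H -> y (g * h)%g = h (y g)) ->
  exists t, forall g, teval 1 g t = y g.
Proof.
move=> yl yr.
have [x xP] : exists x : 'I_(\dim {:kT}) -> L,
    forall g : gT, \sum_i x i * g (vsval k_`_i) = y g.
  by apply: embedding_eqs_solvable => s t /rcosetP[h Hh ->]; apply: yl.
have Kx i : x i \in K.
  rewrite -(galois_fixedField galLK); apply/fixedFieldP=> [|h Hh].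
    exact: memvf.
  apply/eqP; rewrite -subr_eq0; apply/eqP; move: i.
  apply: embedding_eqs_inj => g.
  under eq_bigr do rewrite mulrBl.
  rewrite sumrB xP; apply/eqP; rewrite subr_eq0; apply/eqP.
  rewrite -[in RHS](mulgKV h g) (yr _ _ Hh) -xP rmorph_sum.
  apply: eq_bigr => i _.
  by rewrite rmorphM /= -(gal_comp _ h) mulgKV.
exists (\sum_i pure (vsproj K (x i)) k_`_i) => g.
rewrite linear_sum -xP; apply: eq_bigr => i _.
by rewrite /= teval_pure gal_id vsprojK.
Qed.

Lemma teval_mulHl h s t : h \in H -> teval 1 (h * s) t = teval 1 s t.
Proof.
by move=> Hh; apply: teval_coset; rewrite ?rcoset_refl // mem_rcoset mulgK.
Qed.

Lemma teval_mulHr h s t : h \in H -> teval 1 (s * h) t = h (teval 1 s t).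
Proof.
move=> Hh; rewrite gal_teval; apply: teval_coset; last exact: rcoset_refl.
by rewrite mem_rcoset !mul1g groupV.
Qed.

Lemma ideal_mull (I : {vspace KK}) t u : is_ideal I -> u \in I -> t * u \in I.
Proof. by case/andP=> /subvP sI _ Iu; apply: sI; rewrite memv_mul ?memvf. Qed.

(** Rescaling by the inverses of its values turns an element of I that does not
    vanish at g into a u_g in I with value 1 at g.  Let p be the product of the
    1 - u_g: it vanishes on the support of t, so t = t (1 - p), and 1 - p is
    in I. *)
Lemma ideal_support (I : {vspace KK}) t : is_ideal I ->
  (forall g, teval 1 g t != 0 -> exists2 u, u \in I & teval 1 g u != 0) ->
  t \in I.
Proof.
move=> idI supp.
have /fin_all_exists[u uP] g :
    exists u, u \in I /\ (teval 1 g t != 0 -> teval 1 g u = 1).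
  have [t0 | nz] := eqVneq (teval 1 g t) 0; first by exists 0; rewrite mem0v.
  have [w Iw wg] := supp g nz.
  have [w' w'P] : exists w', forall s, teval 1 s w' = (teval 1 s w)^-1.
    apply: teval_surj => h s Hh; first by rewrite teval_mulHl.
    by rewrite teval_mulHr // fmorphV.
  exists (w' * w); split=> [|_]; first exact: ideal_mull.
  by rewrite tevalM w'P mulVf.
pose p : KK := \prod_g (1 - u g).
have Ip : 1 - p \in I.
  rewrite /p; elim/big_ind: _ => [|x y Ix Iy|g _]; first by rewrite subrr mem0v.
    have -> : 1 - x * y = (1 - x) + x * (1 - y).
      by rewrite mulrBr mulr1 addrA subrK.
    by rewrite memvD // ideal_mull.
  by rewrite opprB addrC subrK; case: (uP g).
have -> : t = t * (1 - p).
  apply/eqP; rewrite mulrBr mulr1 -subr_eq0 subKr; apply/eqP/teval_inj => g.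
  have [t0 | nz] := eqVneq (teval 1 g t) 0; first by rewrite tevalM t0 mul0r.
  rewrite tevalM (big_morph (teval 1 g) (tevalM _ g) (teval1 _ g)).
  rewrite (bigD1 g) //= linearB /= teval1; case: (uP g) => _ -> //.
  by rewrite subrr mul0r mulr0.
exact: ideal_mull.
Qed.

Lemma biset_indicator (S : {set gT}) : is_biset K S ->
  exists t, forall g, teval 1 g t = (g \in S)%:R.
Proof.
case/and3P=> _ /subsetP HS /subsetP SH; apply: teval_surj => h g Hh.
  congr (nat_of_bool _)%:R; apply/idP/idP=> Sg; last by rewrite HS ?mem_mulg.
  by rewrite -(mulKg h g) HS ?mem_mulg ?groupV.
rewrite rmorph_nat; congr (nat_of_bool _)%:R; apply/idP/idP=> Sg; last first.
  by rewrite SH ?mem_mulg.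
by rewrite -(mulgK h g) SH ?mem_mulg ?groupV.
Qed.

Lemma double_coset_biset (g : gT) : is_biset K (H :* g * H)%g.
Proof.
apply/and3P; split; first by apply/subsetP=> s _; apply: mem_gal1.
  by rewrite !mulgA mulGid.
by rewrite -mulgA mulGid.
Qed.

Lemma double_coset_refl (g : gT) : g \in (H :* g * H)%g.
Proof. by rewrite -[X in X \in _]mulg1 mem_mulg ?rcoset_refl ?group1. Qed.

Lemma teval_dc_eq0 g s t :
  s \in (H :* g * H)%g -> (teval 1 s t == 0) = (teval 1 g t == 0).
Proof.
case/mulsgP=> r h /rcosetP[h' Hh' ->] Hh ->.
by rewrite teval_mulHr // fmorph_eq0 teval_mulHl.
Qed.

(** The elements vanishing off HgH form an ideal contained in every ideal that
    does not vanish at g; this makes it the minimal ideal that the description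
    operator selects. *)
Lemma mem_Kdc g t :
  reflect (forall s, s \notin (H :* g * H)%g -> teval 1 s t = 0)
          (t \in Kdc K g).
Proof.
pose I := (\bigcap_(s | s \notin (H :* g * H)%g) lker (pi_coset K s))%VS.
have IP u :
    reflect (forall s, s \notin (H :* g * H)%g -> teval 1 s u = 0) (u \in I).
  rewrite memvE; apply: (iffP subv_bigcapP) => uP s Ns.
    by have := uP s Ns; rewrite -memvE memv_ker pi_cosetE => /eqP.
  by rewrite -memvE memv_ker pi_cosetE uP.
have idI : is_ideal I.
  apply/andP; split; apply/prodvP=> u w.
    by move=> _ /IP Iw; apply/IP=> s Ns; rewrite tevalM Iw ?mulr0.
  by move=> /IP Iu _; apply/IP=> s Ns; rewrite tevalM Iu ?mul0r.
have sub J u : is_ideal J -> u \in J -> teval 1 g u != 0 -> (I <= J)%VS.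
  move=> idJ Ju ug; apply/subvP=> t' /IP It; apply: ideal_support => // s nz.
  exists u => //; rewrite (@teval_dc_eq0 g) //.
  by apply: contraNT nz => /It ->.
suff -> : Kdc K g = I by apply: IP.
have [e eP] := biset_indicator (double_coset_biset g).
have Ie : e \in I by apply/IP=> s /negPf Ns; rewrite eP Ns.
have eg : teval 1 g e != 0 by rewrite eP double_coset_refl oner_neq0.
have minI : minimal_ideal I /\ ~~ (I <= lker (pi_coset K g))%VS.
  split; last first.
    by apply: contra eg => /subvP/(_ e Ie); rewrite memv_ker pi_cosetE.
  split=> // [I0|J idJ JI].
    by move: Ie eg; rewrite I0 memv0 => /eqP ->; rewrite linear0 eqxx.
  have [-> | nzJ] := eqVneq J 0%VS; [by left | right].
  apply/eqP; rewrite eqEsubv JI /= (sub J (vpick J)) ?memv_pick //.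
  apply: contra_neq nzJ => pg.
  apply/eqP; rewrite -vpick0; apply/eqP/teval_inj => s.
  have /IP Ip : vpick J \in I by apply: (subvP JI); apply: memv_pick.
  have [gs | /Ip //] := boolP (s \in (H :* g * H)%g).
  by apply/eqP; rewrite (@teval_dc_eq0 g) // pg.
have [[idE nzE minE] /subvPn[u Eu ug]] :
    minimal_ideal (Kdc K g) /\ ~~ (Kdc K g <= lker (pi_coset K g))%VS.
  by apply: (ClassicalEpsilon.epsilon_spec _ (fun J => minimal_ideal J /\
    ~~ (J <= lker (pi_coset K g))%VS)); exists I.
rewrite memv_ker pi_cosetE in ug.
have [I0 | //] := minE I idI (sub _ u idE Eu ug).
by move: Ie eg; rewrite I0 memv0 => /eqP ->; rewrite linear0 eqxx.
Qed.
End Embeddings.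

Arguments teval {F L K} (s r)%_g.

(** * The entries of an element of A *)

Section Algebra.
Variables (F : fieldType) (A : falgType F) (L : splittingFieldType F).
Variables (K : {subfield L}) (j : 'AHom(subvs_of K, A)) (v : A).
Hypothesis galL : galois 1 {:L}.
Hypothesis dimA : \dim {:A} = (\dim K ^ 2)%N.
Hypothesis KvK : (limg j * <[v]> * limg j = {:A})%VS.

Local Notation gT := (gal_of {:L}).
Local Notation H := 'Gal({:L} / K)%g.
Local Notation kT := (subvs_of K).
Local Notation k_ := (vbasis {:kT}).
Local Notation KK := (tensor kT kT).

Lemma phi_pure x y : phi j v (pure x y) = j x * v * j y.
Proof.
rewrite lfunE /= tlift_pure // => [b | a] c u w.
  by rewrite !linearP /= !mulrDl -!scalerAl.
by rewrite !linearP /= mulrDr scalerAr.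
Qed.

Lemma phi1 : phi j v 1 = v.
Proof. by rewrite [1 : KK]/(pure 1 1) phi_pure !rmorph1 mulr1 mul1r. Qed.

Lemma phiM x y t : phi j v (pure x y * t) = j x * phi j v t * j y.
Proof.
move: t; apply: (tensor_ext (g := fun t => phi j v (pure x y * t))
  (h := fun t => j x * phi j v t * j y)) => [a t t' | a t t' | x' y'].
- by rewrite mulrDr -scalerAr linearP.
- by rewrite linearP mulrDr -scalerAr mulrDl -scalerAl.
by rewrite pureM !phi_pure (mulrC y) !rmorphM /= !mulrA.
Qed.

Lemma limg_phi : limg (phi j v) = {:A}%VS.
Proof.
apply/eqP; rewrite eqEsubv subvf -KvK.
apply/prodvP=> u _ Vu /memv_imgP[y _ ->].
suff /subvP/(_ u Vu) : (limg j * <[v]> <= amulr (j y) @^-1: limg (phi j v))%VS.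
  by rewrite -memv_preim lfunE.
apply/prodvP=> _ _ /memv_imgP[x _ ->] /vlineP[c ->].
rewrite -memv_preim lfunE /= -scalerAr -scalerAl memvZ // -phi_pure.
by rewrite memv_img ?memvf.
Qed.

Lemma lker_phi : lker (phi j v) == 0%VS.
Proof.
have := limg_ker_dim (phi j v) fullv.
rewrite capfv limg_phi dimA [\dim {:KK}]dimvf /= /dim /= !dimvf /= -mulnn.
move=> /eqP.
by rewrite -[X in _ == X]add0n eqn_add2r dimv_eq0.
Qed.

Lemma phiK : cancel (phi j v) (phi j v)^-1%VF.
Proof. exact/lker0_lfunK/lker_phi. Qed.

Lemma phiVK : cancel (phi j v)^-1%VF (phi j v).
Proof. by move=> a; apply: limg_lfunVK; rewrite limg_phi memvf. Qed.

Definition entry (s r : gT) : 'Hom(A, L) := (teval s r \o (phi j v)^-1)%VF.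
Arguments entry (s r)%_g.

Lemma entry_phi s r t : entry s r (phi j v t) = teval s r t.
Proof. by rewrite lfunE /= phiK. Qed.

Lemma entry_v s r : entry s r v = 1.
Proof. by rewrite -phi1 entry_phi teval1. Qed.

Lemma entry_bimod s r x a y :
  entry s r (j x * a * j y) = s (vsval x) * r (vsval y) * entry s r a.
Proof. by rewrite -(phiVK a) -phiM !entry_phi tevalM teval_pure. Qed.

Lemma entry_mull s r x a : entry s r (j x * a) = s (vsval x) * entry s r a.
Proof. by rewrite -[j x * a]mulr1 -(rmorph1 j) entry_bimod !rmorph1 mulr1. Qed.

Lemma entry_mulr s r a y : entry s r (a * j y) = r (vsval y) * entry s r a.
Proof. by rewrite -[a]mul1r -(rmorph1 j) entry_bimod !rmorph1 !mul1r. Qed.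

Lemma gal_entry (g s r : gT) a : g (entry s r a) = entry (s * g) (r * g) a.
Proof. by rewrite -(phiVK a) !entry_phi gal_teval. Qed.

Lemma entry_coset s s' r r' a :
  s \in (H :* s')%g -> r \in (H :* r')%g -> entry s r a = entry s' r' a.
Proof. by rewrite -(phiVK a) !entry_phi; apply: teval_coset. Qed.

(** For fixed s and r, the map k |-> entry s r (v k v) from K to L is a
    combination of the embeddings; its coefficients are the structure constants,
    and the general product x v y * x' v y' reduces to v (y x') v.  The explicit
    coefficients given by [dual_family] inherit its equivariance. *)
Lemma struct_exist : exists c : gT -> gT -> gT -> L,
  [/\ forall s r a b, entry s r (a * b) =
        \sum_(t in coset_reps K) c s t r * (entry s t a * entry t r b),
      forall g s t r : gT, g (c s t r) = c (s * g)%g (t * g)%g (r * g)%g &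
      forall s s' t t' r r', s \in (H :* s')%g -> t \in (H :* t')%g ->
        r \in (H :* r')%g -> c s t r = c s' t' r'].
Proof.
have [l [_ lH lgal lcoord]] := dual_family K galL.
exists (fun s t r => \sum_i l t i * entry s r (v * j k_`_i * v)).
split=> [s r a b | g s t r | s s' t t' r r' ss tt rr]; last first.
- by apply: eq_bigr => i _; rewrite (lH _ _ _ tt) (entry_coset _ ss rr).
- rewrite rmorph_sum; apply: eq_bigr => i _.
  by rewrite rmorphM /= gal_entry lgal.
pose c t := \sum_i l t i * entry s r (v * j k_`_i * v).
have vkv k :
    entry s r (v * j k * v) = \sum_(t in coset_reps K) c t * t (vsval k).
  under eq_bigr do rewrite mulr_suml.
  rewrite exchange_big {1}(coord_vbasis (memvf k)) /=.
  rewrite linear_sum mulr_sumr mulr_suml linear_sum.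
  apply: eq_bigr => i _ /=.
  under eq_bigr do rewrite mulrAC.
  by rewrite -mulr_suml lcoord mulr_algl linearZ /= -scalerAr -scalerAl linearZ.
rewrite -(phiVK a) -(phiVK b); move: (_ a) (_ b) => {a b} p q.
under eq_bigr do rewrite !entry_phi.
move: p; apply: (tensor_ext (g := fun p => entry s r (phi j v p * phi j v q))
  (h := fun p => \sum_(t in coset_reps K) c t * (teval s t p * teval t r q)))
  => [x p p' | x p p' | x y].
- by rewrite linearP mulrDl -scalerAl linearP.
- rewrite scaler_sumr -big_split; apply: eq_bigr => t _ /=.
  by rewrite linearP mulrDl mulrDr -scalerAl -scalerAr.
move: q; apply: (tensor_ext
  (g := fun q => entry s r (phi j v (pure x y) * phi j v q))
  (h := fun q =>
     \sum_(t in coset_reps K) c t * (teval s t (pure x y) * teval t r q)))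
  => [z p p' | z p p' | x' y'].
- by rewrite linearP mulrDr -scalerAr linearP.
- rewrite scaler_sumr -big_split; apply: eq_bigr => t _ /=.
  by rewrite linearP !mulrDr -!scalerAr.
rewrite !phi_pure.
have -> : j x * v * j y * (j x' * v * j y') = j x * (v * j (y * x') * v) * j y'.
  by rewrite rmorphM /= !mulrA.
rewrite entry_bimod vkv mulr_sumr; apply: eq_bigr => t _.
rewrite !teval_pure !rmorphM /=.
rewrite mulrCA; congr (_ * _); rewrite -!mulrA; congr (_ * _).
by rewrite mulrC !mulrA.
Qed.

(** 1 commutes with K, so s(k) and r(k) have the same product with this entry
    for all k in K. *)
Lemma entry1_offdiag s r : s \notin (H :* r)%g -> entry s r 1 = 0.
Proof.
apply: contraNeq => nz; apply/eq_embeddingP => k; apply: (mulIf nz).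
by rewrite -entry_mull -entry_mulr mulr1 mul1r.
Qed.

Lemma entry1_diag : entry 1 1 1 != 0.
Proof.
have [c [entryM _ _]] := struct_exist.
have : entry 1 1 (1 * v) != 0 by rewrite mul1r entry_v oner_neq0.
rewrite entryM; apply: contraNneq => e11; apply/eqP; apply: big1 => t Xt.
have [t1 | t1] := boolP (t \in (H :* 1)%g).
  by rewrite (entry_coset 1 (rcoset_refl _ 1%g) t1) e11 mul0r mulr0.
by rewrite entry1_offdiag ?mul0r ?mulr0 // -coset_rep_eq eq_sym coset_rep_eq.
Qed.

(** * The structure constants do not vanish *)

Section StructureConstants.
Variable c : gT -> gT -> gT -> L.
Arguments c (_ _ _)%_g.
Hypothesis entryM : forall s r a b, entry s r (a * b) =
  \sum_(t in coset_reps K) c s t r * (entry s t a * entry t r b).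
Hypothesis gal_struct : forall g s t r : gT,
  g (c s t r) = c (s * g) (t * g) (r * g).
Hypothesis struct_coset : forall s s' t t' r r', s \in (H :* s')%g ->
  t \in (H :* t')%g -> r \in (H :* r')%g -> c s t r = c s' t' r'.

(** Compare the entries of (v k v) k' v and v k (v k' v): both sides are
    coefficients of the same combination of the t(k) r(k'). *)
Lemma struct_cocycle s t r p : c s r p * c s t r = c s t p * c t r p.
Proof.
have rK u : u \in (H :* coset_rep K u)%g by rewrite coset_rep_coset rcoset_refl.
have refl u : u \in (H :* u)%g by apply: rcoset_refl.
pose D t r := c s r p * c s t r - c s t p * c t r p.
suff DX t' r' : t' \in coset_reps K -> r' \in coset_reps K -> D t' r' = 0.
  apply/eqP; rewrite -subr_eq0 (struct_coset (refl s) (rK r) (refl p)).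
  rewrite (struct_coset (refl s) (rK t) (rK r)).
  rewrite (struct_coset (refl s) (rK t) (refl p)).
  rewrite (struct_coset (rK t) (rK r) (refl p)); apply/eqP.
  by apply: DX; apply: coset_rep_reps.
move=> Xt Xr.
move: r' Xr; apply: (embeddings_independent galL (c := D t')) => k'.
move: t' Xt; apply: (embeddings_independent galL
  (c := fun t => \sum_(r in coset_reps K) D t r * r (vsval k'))) => k.
have lE : entry s p (v * (j k * v) * (j k' * v)) = \sum_(t in coset_reps K)
    \sum_(r in coset_reps K) c s r p * c s t r * (t (vsval k) * r (vsval k')).
  rewrite entryM exchange_big; apply: eq_bigr => r' _ /=.
  rewrite entry_mull entry_v mulr1 entryM mulr_suml mulr_sumr.
  apply: eq_bigr => t' _.
  by rewrite entry_mull !entry_v mulr1 mul1r !mulrA.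
have rE : entry s p (v * j k * (v * (j k' * v))) = \sum_(t in coset_reps K)
    \sum_(r in coset_reps K) c s t p * c t r p * (t (vsval k) * r (vsval k')).
  rewrite entryM; apply: eq_bigr => t' _ /=.
  rewrite entry_mulr entry_v mulr1 entryM !mulr_sumr; apply: eq_bigr => r' _.
  by rewrite entry_mull !entry_v mulr1 mul1r mulrACA !mulrA.
have : entry s p (v * (j k * v) * (j k' * v)) =
       entry s p (v * j k * (v * (j k' * v))).
  by rewrite !mulrA.
rewrite lE rE => /eqP; rewrite -subr_eq0 -sumrB => /eqP e; rewrite -[RHS]e.
apply: eq_bigr => t' _; rewrite mulr_suml -sumrB; apply: eq_bigr => r' _.
by rewrite -mulrBl -mulrA (mulrC (r' _)).
Qed.

(** In the expansion of 1 = entry s r (1 * v) only the term t = s survives. *)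
Lemma struct_left_neq0 s r : c s s r != 0.
Proof.
have : entry s r (1 * v) != 0 by rewrite mul1r entry_v oner_neq0.
rewrite entryM (bigD1 (coset_rep K s)) ?coset_rep_reps //=.
rewrite big1 ?addr0 => [|t /andP[Xt tNs]].
  apply: contraNneq => c0; rewrite (struct_coset (s' := s) (t' := s) (r' := r));
    rewrite ?c0 ?mul0r ?coset_rep_coset ?rcoset_refl //.
  by rewrite -coset_rep_eq coset_rep_id ?coset_rep_reps.
rewrite entry1_offdiag ?mul0r ?mulr0 //.
by rewrite -coset_rep_eq (coset_rep_id Xt) eq_sym.
Qed.

Hypothesis simpleA : forall I : {vspace A}, is_ideal I -> I = 0%VS \/ I = fullv.

(** Simplicity enters here: the ideal N below is proper, hence zero, whereas a
    zero c s t s would put into N the elements of A supported on the double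
    coset of t s^-1. *)
Lemma struct_sym_neq0 s t : c s t s != 0.
Proof.
pose N := (\bigcap_(p : gT * gT | c p.1 p.2 p.1 != 0%R)
             lker (entry p.1 p.2))%VS.
have NP a : reflect (forall s t, c s t s != 0 -> entry s t a = 0) (a \in N).
  rewrite memvE; apply: (iffP subv_bigcapP) => [aN s' t' st | aN [s' t'] /= st].
    by have := aN (s', t') st; rewrite -memvE memv_ker => /eqP.
  by rewrite -memvE memv_ker aN.
have idN : is_ideal N.
  apply/andP; split; apply/prodvP => a b.
    move=> _ /NP Nb; apply/NP => s' t' st; rewrite entryM big1 // => r _.
    have [/Nb -> | crtr] := boolP (c r t' r != 0); first by rewrite !mulr0.
    (* c_{r,t',r} = 0 forces c_{s',r,t'} = 0, through c_{s',t',r} <> 0. *)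
    have: c s' t' r != 0.
      have := struct_cocycle s' t' s' r.
      have : c s' s' r * c s' t' s' != 0 by rewrite mulf_neq0 ?struct_left_neq0.
      by move=> nz e; move: nz; rewrite e mulf_eq0 negb_or => /andP[].
    move=> /negPf cstr; have /eqP := struct_cocycle s' r t' r.
    rewrite (eqP (negbNE crtr)) mulr0 mulf_eq0 cstr => /eqP ->.
    by rewrite mul0r.
  move=> /NP Na _; apply/NP => s' t' st; rewrite entryM big1 // => r _.
  have [/Na -> | csrs] := boolP (c s' r s' != 0); first by rewrite mul0r mulr0.
  have /eqP := struct_cocycle s' r t' s'.
  rewrite (eqP (negbNE csrs)) mul0r mulf_eq0 (negPf st) => /eqP ->.
  by rewrite mul0r.
have [N0 | NT] := simpleA idN; last first.
  have : (1 : A) \in N by rewrite NT memvf.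
  move/NP/(_ 1 1 (struct_left_neq0 _ _))%g/eqP.
  by rewrite (negPf entry1_diag).
apply/eqP => cst0.
have [e eP] := biset_indicator galL (double_coset_biset K (t * s^-1)%g).
suff : phi j v e \in N.
  rewrite N0 memv0 => /eqP e0.
  have := eP (t * s^-1)%g; rewrite double_coset_refl -entry_phi e0 linear0.
  move/esym/eqP.
  by rewrite oner_eq0.
apply/NP=> s' t' nz.
have -> : entry s' t' (phi j v e) =
          s' (entry 1 (t' * s'^-1) (phi j v e)).
  by rewrite gal_entry mul1g mulgKV.
rewrite entry_phi eP; case: (boolP (_ \in _)) => [|_]; last by rewrite rmorph0.
case/mulsgP=> u h2 /rcosetP[h1 Hh1 ->] Hh2 e1.
have t'E : t' = (h1 * (t * s^-1 * h2 * s'))%g.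
  by rewrite -(mulgKV s' t') e1 !mulgA.
(* The translate by q sends (s, t) to (s', t') up to H. *)
pose q := (s^-1 * h2 * s')%g.
have := gal_struct q s t s; rewrite cst0 rmorph0 => q0.
have sq : (s * q)%g = (h2 * s')%g by rewrite /q !mulgA mulgV mul1g.
have tq : t' = (h1 * (t * q))%g by rewrite t'E /q !mulgA.
have Hs' : s' \in (H :* (s * q))%g by rewrite sq mem_rcoset invMg mulKVg groupV.
case/eqP: nz; rewrite [RHS]q0; apply: struct_coset => //.
by rewrite tq mem_rcoset mulgK.
Qed.

(** The cocycle identity c_{s,s,r} c_{s,t,s} = c_{s,t,r} c_{t,s,r} has a nonzero
    left-hand side. *)
Lemma struct_neq0 s t r : c s t r != 0.
Proof.
have := struct_cocycle s t s r; have : c s s r * c s t s != 0.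
  by rewrite mulf_neq0 ?struct_left_neq0 ?struct_sym_neq0.
by move=> nz e; move: nz; rewrite e mulf_eq0 negb_or => /andP[].
Qed.
End StructureConstants.

(** * Bimodules and bisets *)

Section Bimodules.
Local Notation is_subbimod := (is_subbimod j).

(** The preimage of V in K \otimes K is an ideal, so [ideal_support] applies. *)
Lemma subbimod_support (V : {vspace A}) a : is_subbimod V ->
  (forall g, entry 1 g a != 0 -> exists2 u, u \in V & entry 1 g u != 0) ->
  a \in V.
Proof.
case/andP=> /subvP KV /subvP VK supp.
pose I := (phi j v @^-1: V)%VS.
have IP t : (t \in I) = (phi j v t \in V) by rewrite memv_preim.
have Il t u : u \in I -> t * u \in I.
  rewrite !IP (tensorE t) => Iu.
  rewrite mulr_suml linear_sum memv_suml // => m _.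
  rewrite mulr_suml linear_sum memv_suml // => n _.
  rewrite -scalerAl linearZ /= memvZ // phiM VK // memv_mul ?memv_img ?memvf //.
  by rewrite KV // memv_mul ?memv_img ?memvf.
have mulC (t u : KK) : t * u = u * t.
  apply: subr0_eq; apply: (teval_inj galL) => g.
  by rewrite linearB /= !tevalM mulrC subrr.
have idI : is_ideal I.
  apply/andP; split; apply/prodvP=> t u It Iu; first exact: Il.
  by rewrite mulC Il.
rewrite -(phiVK a) -IP; apply: (ideal_support galL) => // g.
rewrite -entry_phi phiVK => /supp[u Vu ug].
by exists ((phi j v)^-1%VF u); rewrite ?IP ?phiVK // -entry_phi phiVK.
Qed.

Lemma Phi_subbimod (S : {set gT}) : is_subbimod (Phi_map j v S).
Proof.
rewrite /Phi_map; elim/big_ind: _ => [|V W HV HW|g _].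
- exact: vspace0_is_subbimod.
- exact: (addv_is_subbimod (Subbimod HV) (Subbimod HW)).
have KP := mem_Kdc galL g; apply/andP; split; apply/prodvP.
  move=> _ _ /memv_imgP[x _ ->] /memv_imgP[u /KP Ku ->].
  rewrite -[_ * _]mulr1 -(rmorph1 j) -phiM memv_img //; apply/KP=> s Ns.
  by rewrite tevalM Ku ?mulr0.
move=> _ _ /memv_imgP[u /KP Ku ->] /memv_imgP[x _ ->].
rewrite -[_ * _]mul1r -(rmorph1 j) mulrA -phiM memv_img //; apply/KP=> s Ns.
by rewrite tevalM Ku ?mulr0.
Qed.

(** Each K_[g] with HgH in S vanishes off S.  Conversely the sum defining Phi(S)
    is a bimodule that contains an element not vanishing at g for each g in S,
    so it contains everything supported on S. *)
Lemma mem_Phi (S : biset K) a :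
  reflect (forall g, g \notin (S : {set gT}) -> entry 1 g a = 0)
          (a \in Phi_map j v S).
Proof.
have /and3P[_ /subsetP HS /subsetP SH] := valP S.
have dcS g : g \in (S : {set gT}) -> (H :* g * H)%g \subset S.
  move=> Sg; apply/subsetP=> _ /mulsgP[_ h /rcosetP[h' Hh' ->] Hh ->].
  by rewrite SH ?mem_mulg // HS ?mem_mulg.
apply: (iffP idP) => [Sa g NSg | aS].
  apply/eqP; rewrite -memv_ker; move: Sa.
  apply/subvP/subv_sumP => s /andP[_ sS].
  apply/subvP=> _ /memv_imgP[u /(mem_Kdc galL) Ku ->].
  by rewrite memv_ker entry_phi Ku //; apply: contra NSg; apply: (subsetP sS).
apply: subbimod_support (Phi_subbimod S) _ => g nz.
have Sg : g \in (S : {set gT}) by apply: contraNT nz => /aS ->.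
have [e eP] := biset_indicator galL (double_coset_biset K g).
exists (phi j v e); last by rewrite entry_phi eP double_coset_refl oner_neq0.
have /subvP : (phi j v @: Kdc K g <= Phi_map j v S)%VS.
  by apply: (sumv_sup g) => //; rewrite mem_gal1 dcS.
apply; rewrite memv_img //; apply/(mem_Kdc galL) => s /negPf Ns.
by rewrite eP Ns.
Qed.

Lemma Phi_witness (S : biset K) g : g \in (S : {set gT}) ->
  exists2 a, a \in Phi_map j v S & entry 1 g a != 0.
Proof.
move=> Sg; have [e eP] := biset_indicator galL (valP S).
exists (phi j v e); last by rewrite entry_phi eP Sg oner_neq0.
by apply/mem_Phi => s /negPf Ns; rewrite entry_phi eP Ns.
Qed.

(** To bound Phi(S) from above by a bimodule V, it is enough that V does not
    vanish at any point of S; this gives one inclusion in each of the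
    semiring identities below. *)
Lemma Phi_sub (S : biset K) (V : {vspace A}) : is_subbimod V ->
  (forall g, g \in (S : {set gT}) -> exists2 u, u \in V & entry 1 g u != 0) ->
  (Phi_map j v S <= V)%VS.
Proof.
move=> HV supp; apply/subvP=> a /mem_Phi aS.
apply: subbimod_support HV _ => g nz.
by apply: supp; apply: contraNT nz => /aS ->.
Qed.

Lemma Phi_subset (S S' : biset K) :
  (Phi_map j v S <= Phi_map j v S')%VS = (S \subset (S' : {set gT})).
Proof.
apply/idP/subsetP => [/subvP SS' g Sg | SS'].
  have [a Sa] := Phi_witness Sg; apply: contraNT => NSg.
  by have /mem_Phi -> := SS' a Sa.
apply/subvP=> a /mem_Phi Sa; apply/mem_Phi=> g Ng.
by apply: Sa; apply: contra Ng; apply: SS'.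
Qed.

Lemma Phi0 : Phi_map j v (biset0 K) = 0%VS.
Proof.
apply/eqP; rewrite -subv0; apply: Phi_sub (vspace0_is_subbimod j) _ => g.
by rewrite inE.
Qed.

Lemma PhiU (S S' : biset K) :
  Phi_map j v (bisetU S S') = (Phi_map j v S + Phi_map j v S')%VS.
Proof.
apply/eqP; rewrite eqEsubv; apply/andP; split.
  apply: Phi_sub.
    exact: (addv_is_subbimod (Subbimod (Phi_subbimod S))
                             (Subbimod (Phi_subbimod S'))).
  by move=> g /setUP[] /Phi_witness[u Su ug]; exists u => //; move: u Su {ug};
    apply/subvP; rewrite ?addvSl ?addvSr.
by rewrite subv_add !Phi_subset subsetUl subsetUr.
Qed.

Lemma Phi1 : Phi_map j v (biset1 K) = limg j.
Proof.
apply/eqP; rewrite eqEsubv; apply/andP; split.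
  apply: Phi_sub (limg_is_subbimod j) _ => h Hh; exists 1; first exact: limg1.
  rewrite (entry_coset (s' := 1%g) (r' := 1%g)) ?entry1_diag ?rcoset_refl //.
  by rewrite mem_rcoset invg1 mulg1.
apply/subvP=> _ /memv_imgP[x _ ->]; apply/mem_Phi => g Ng.
rewrite -[j x]mulr1 entry_mull entry1_offdiag ?mulr0 //.
by rewrite mem_rcoset mul1g groupV.
Qed.

Hypothesis simpleA : forall I : {vspace A}, is_ideal I -> I = 0%VS \/ I = fullv.

(** If a and b do not vanish at s and s', Dedekind provides a k in K such that
    a k b does not vanish at the composite of s and s', because the structure
    constants are nonzero. *)
Lemma PhiM (S S' : biset K) :
  Phi_map j v (biset_mul S S') = (Phi_map j v S * Phi_map j v S')%VS.
Proof.
have [c [entryM gal_struct struct_coset]] := struct_exist.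
apply/eqP; rewrite eqEsubv; apply/andP; split; last first.
  apply/prodvP=> a b /mem_Phi Sa /mem_Phi Sb; apply/mem_Phi => g Ng.
  rewrite entryM big1 // => t _.
  have [St | /Sa -> ] := boolP (t \in (S : {set gT})); last first.
    by rewrite mul0r mulr0.
  have -> : entry t g b = t (entry 1 (g * t^-1) b).
    by rewrite gal_entry mul1g mulgKV.
  rewrite Sb ?rmorph0 ?mulr0 //; apply: contra Ng => S't.
  by apply/imset2P; exists t (g * t^-1)%g; rewrite ?mulgKV.
apply: Phi_sub.
  exact: (prodv_is_subbimod (Subbimod (Phi_subbimod S))
                            (Subbimod (Phi_subbimod S'))).
move=> _ /imset2P[s s' Ss Ss' ->].
have [a Sa sa] := Phi_witness Ss; have [b Sb sb] := Phi_witness Ss'.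
have /andP[_ /subvP SK] := Phi_subbimod S.
pose D t := c 1%g t (s' * s)%g * (entry 1 t a * entry t (s' * s) b).
suff : ~~ (Phi_map j v S * Phi_map j v S' <= lker (entry 1 (s' * s)))%VS.
  by case/subvPn=> u Vu; rewrite memv_ker; exists u.
apply/negP=> /subvP kerV.
suff D0 : D (coset_rep K s) = 0.
  have c_neq0 := struct_neq0 entryM gal_struct struct_coset simpleA.
  move/eqP: D0; rewrite !mulf_eq0 (negPf (c_neq0 _ _ _)) /=.
  have sK : coset_rep K s \in (H :* s)%g.
    by rewrite -coset_rep_eq coset_rep_id ?coset_rep_reps.
  rewrite (entry_coset a (rcoset_refl _ _) sK) (negPf sa) /=.
  rewrite (entry_coset b sK (rcoset_refl _ _)) -[X in entry X]mul1g -gal_entry.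
  by rewrite fmorph_eq0 (negPf sb).
apply: (embeddings_independent galL (c := D)) (coset_rep_reps K s) => k.
have : a * j k * b \in (Phi_map j v S * Phi_map j v S')%VS.
  by rewrite memv_mul // SK // memv_mul ?memv_img ?memvf.
move/kerV; rewrite memv_ker entryM => /eqP e; rewrite -[RHS]e.
apply: eq_bigr => t _.
by rewrite entry_mulr /D -!mulrA; congr (_ * _); rewrite mulrA mulrC.
Qed.

Definition nonvanishing (V : {vspace A}) : {set gT} :=
  [set g | ~~ (V <= lker (entry 1 g))%VS].

Lemma supportP (V : {vspace A}) g :
  reflect (exists2 u, u \in V & entry 1 g u != 0) (g \in nonvanishing V).
Proof.
rewrite inE.
apply: (iffP idP) => [/subvPn[u Vu ug] | [u Vu ug]]; last apply/subvPn;
  exists u => //; move: ug;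
  by rewrite memv_ker.
Qed.

Lemma support_is_biset (V : {vspace A}) : is_biset K (nonvanishing V).
Proof.
apply/and3P; split; first by apply/subsetP=> g _; apply: mem_gal1.
  apply/subsetP=> _ /mulsgP[h g Hh /supportP[u Vu ug] ->]; apply/supportP.
  exists u => //; rewrite (entry_coset u (rcoset_refl _ _) (r' := g)) //.
  by rewrite mem_rcoset mulgK.
apply/subsetP=> _ /mulsgP[g h /supportP[u Vu ug] Hh ->]; apply/supportP.
exists u => //; have h1 : 1%g \in (H :* (1 * h))%g.
  by rewrite mem_rcoset !mul1g groupV.
by rewrite (entry_coset u h1 (rcoset_refl _ _)) -gal_entry fmorph_eq0.
Qed.

Definition supp_biset V := Biset (support_is_biset V).

Lemma support_Phi (S : biset K) : supp_biset (Phi_map j v S) = S.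
Proof.
apply/val_inj/setP=> g.
apply/supportP/idP => [[u /mem_Phi Su] | /Phi_witness //].
by apply: contraNT => /Su ->.
Qed.

Lemma Phi_support (V : {vspace A}) : is_subbimod V ->
  Phi_map j v (supp_biset V) = V.
Proof.
move=> HV; apply/eqP; rewrite eqEsubv Phi_sub //= => [|g /supportP //].
apply/subvP=> u Vu; apply/(mem_Phi (supp_biset V)) => g.
rewrite inE negbK => /subvP/(_ u Vu).
by rewrite memv_ker => /eqP.
Qed.
End Bimodules.
End Algebra.

Theorem theorem19 (F : fieldType) (A : falgType F) (n : nat)
    (L : splittingFieldType F) (K : {subfield L})
    (j : 'AHom(subvs_of K, A)) (v : A) :
  central_simple A -> \dim {:A} = (n ^ 2)%N ->
  maximal_subfield (limg j) -> separable 1 K -> \dim K = n ->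
  galois_closure K ->
  (limg j * <[v]> * limg j = {:A})%VS ->
  exists Phi : {rmorphism biset K -> subbimod j},
    (forall S : biset K, Phi S = Phi_map j v S :> {vspace A})
    /\ bijective Phi.
Proof.
move=> [_ simpleA] dimA _ _ dimK [galL _] KvK; rewrite -{}dimK in dimA.
pose f (S : biset K) : subbimod j := Subbimod (Phi_subbimod j v galL S).
have f0 : f 0 = 0 by apply: val_inj; apply: Phi0.
have fD : {morph f : S S' / S + S'} by move=> S S'; apply: val_inj; apply: PhiU.
have f1 : f 1 = 1 by apply: val_inj; apply: Phi1.
have fM : {morph f : S S' / S * S'} by move=> S S'; apply: val_inj; apply: PhiM.
pose Phi : {rmorphism biset K -> subbimod j} := HB.pack f
  (GRing.isNmodMorphism.Build _ _ f (conj f0 fD))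
  (GRing.isMonoidMorphism.Build _ _ f (conj f1 fM)).
exists Phi; split=> //.
exists (fun V : subbimod j => supp_biset dimA KvK V) => [S | V].
  exact: support_Phi.
by apply: val_inj; apply: Phi_support => //; apply: valP.
Qed.
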